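(* Let $A$ be an $n\times n$ trace-zero matrix over an antiring $S$ without nonzero nilpotent elements. Then $A$ can be written as $$A=\sum_{i=1}^{N(n)} B_i ,$$ where each $B_i\in M_n(S)$ is a square-zero matrix (i.e. $B_i^2=0$) and $N(n)$ is the smallest integer such that $$n\le \binom{N(n)}{\left\lceil \frac{N(n)}{2}\right\rceil}.$$ Moreover, for every $n$ there exists a trace-zero matrix $A\in M_n(S)$ such that it cannot be written as a sum of $k$ square-zero matrices, where $k<N(n)$.
   Context: Here $n$ is a positive integer and $M_n(S)$ is the set of $n\times n$ matrices over $S$. A semiring is a set $S$ with operations $+$ and $\cdot$ such that $(S,+)$ is a commutative monoid with identity $0$, $(S,\cdot)$ is a monoid with identity $1$, multiplication distributes over addition, and $0$ annihilates $S$. An antiring is a semiring that is zerosumfree: $a+b=0$ implies $a=b=0$ for all $a,b\in S$. A matrix is trace-zero if its trace (the sum of its diagonal entries) is $0$; over an antiring this is equivalent to all its diagonal entries being $0$. An element $a\in S$ is nilpotent if $a^m=0$ for some positive integer $m$. An empty sum of matrices is the zero matrix.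
   Formalization: In the ''Moreover'' part the antiring S is assumed to satisfy 1 ≠ 0; over the zero semiring that part fails for n ≥ 2, since the only matrix is 0, which is already an empty sum. *)

(* Defs.v *)
From HB Require Import structures.
From mathcomp Require Import all_boot all_order all_algebra.

Set Implicit Arguments.
Unset Strict Implicit.
Unset Printing Implicit Defensive.

Import GRing.Theory.
Local Open Scope ring_scope.

(* [pzSemiRingType] is neither assumed commutative nor assumed to satisfy
   [1 != 0]. *)
Definition antiring (S : pzSemiRingType) : Prop :=
  forall a b : S, a + b = 0 -> a = 0 /\ b = 0.

Definition nilpotent_elt (S : pzSemiRingType) (a : S) : Prop :=
  exists2 m : nat, (0 < m)%N & a ^+ m = 0.

Definition no_nonzero_nilpotent (S : pzSemiRingType) : Prop :=
  forall a : S, nilpotent_elt a -> a = 0.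

Definition trace_zero (S : pzSemiRingType) (n : nat) (A : 'M[S]_n) : Prop :=
  \tr A = 0.

Definition square_zero (S : pzSemiRingType) (n : nat) (B : 'M[S]_n) : Prop :=
  B *m B = 0.

(* The summands need not be distinct or nonzero; for [k = 0] the sum is [0]. *)
Definition sum_of_square_zero (S : pzSemiRingType) (n k : nat)
    (A : 'M[S]_n) : Prop :=
  exists2 B : 'I_k -> 'M[S]_n,
    forall i, square_zero (B i) & A = \sum_(i < k) B i.

Lemma leq_central_bin (n : nat) : (n <= 'C(n.*2, n))%N.
Proof.
elim: n => [|n IHn] //.
rewrite doubleS binS -addn1 addnC leq_add ?bin_gt0 //.
  by rewrite ltnS -addnn leq_addr.
by apply: leq_trans IHn _; case: n => [|n] //; rewrite [leqRHS]binS leq_addr.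
Qed.

Lemma ex_sperner_number (n : nat) : exists N : nat, (n <= 'C(N, uphalf N))%N.
Proof. by exists n.*2; rewrite uphalf_double leq_central_bin. Qed.

(* [uphalf N] is the ceiling of [N / 2]. *)
Definition sperner_number (n : nat) : nat := ex_minn (ex_sperner_number n).

(* Main.v *)
(** A family of distinct subsets of a [k]-set of one size is an antichain, so
    each ordered pair [i != j] can be assigned a colour in [s i :\: s j];
    splitting [A] by colours gives square-zero summands, since a colour never
    labels both [(i, j)] and [(j, l)].  Conversely, suppose that the matrix with
    [0] on the diagonal and [1] elsewhere is the sum of square-zero matrices
    [B c], [c < k].  Expanding the product of the identities
    [1 = \sum_c B c i j] over all pairs [i != j] leaves a nonzero product with
    one colour per pair.  In a reduced semiring all products of two of its
    factors are nonzero, so again no colour labels both [(i, j)] and [(j, l)];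
    the sets of colours occurring in the rows form an antichain, and Sperner's
    theorem bounds [n]. *)
Require Import Defs.
From mathcomp Require Import all_boot all_order all_algebra.
From mathcomp Require Import zify.

Set Implicit Arguments.
Unset Strict Implicit.
Unset Printing Implicit Defensive.

Import GRing.Theory.
Local Open Scope ring_scope.

(** The ratio of the two coefficients is [(n - m) / (m + 1)], at least 1 when [2m < n]. *)
Lemma leq_bin_step (n m : nat) : (m.*2 < n)%N -> ('C(n, m) <= 'C(n, m.+1))%N.
Proof.
move=> lt_mn; rewrite -(leq_pmul2l (ltn0Sn m)) mul_bin_left leq_mul2r.
by rewrite ltn_subRL addnn lt_mn orbT.
Qed.

Lemma leq_bin_half (n m : nat) : (m <= n./2)%N -> ('C(n, m) <= 'C(n, n./2))%N.
Proof.
move=> le_m.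
have [d def_d] : exists d, (m + d = n./2)%N by exists (n./2 - m)%N; lia.
elim: d m {le_m} def_d => [|d IHd] m def_d; first by rewrite -def_d addn0.
by apply: leq_trans (IHd m.+1 _); [apply: leq_bin_step; lia | lia].
Qed.

Lemma leq_bin_uphalf (n m : nat) : ('C(n, m) <= 'C(n, uphalf n))%N.
Proof.
have -> : 'C(n, uphalf n) = 'C(n, n./2).
  by rewrite -bin_sub; [congr 'C(n, _); lia | lia].
have [le_m|lt_m] := leqP m n./2; first exact: leq_bin_half.
have [le_mn|lt_nm] := leqP m n; last by rewrite bin_small.
by rewrite -bin_sub //; apply: leq_bin_half; lia.
Qed.

Definition antichain (T : finType) (F : {set {set T}}) : Prop :=
  {in F &, forall A B : {set T}, A \subset B -> A = B}.

(* Induction on [D]: the members of [F] that avoid a point [x] form an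
   antichain of subsets of [D :\ x], and a member [A != D] avoids exactly
   [#|D| - #|A|] points of [D]. *)
Lemma lubell_yamamoto_meshalkin (T : finType) (D : {set T})
    (F : {set {set T}}) :
  antichain F -> F \subset powerset D ->
  (\sum_(A in F) #|A|`! * (#|D| - #|A|)`! <= #|D|`!)%N.
Proof.
have [k] := ubnP #|D|; elim: k => // k IHk in D F *.
rewrite ltnS => leDk antiF /subsetP sFD.
have subD A : A \in F -> A \subset D by move/sFD; rewrite powersetE.
(* If [D] is a member, it contains every other one, so it is alone and equality holds. *)
have [DF|DnF] := boolP (D \in F).
  have -> : F = [set D].
    apply/setP=> A; rewrite inE; apply/idP/eqP => [AF|->//].
    exact: antiF (subD _ AF).
  by rewrite big_set1 subnn fact0 muln1.
have ltD A : A \in F -> (#|A| < #|D|)%N.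
  move=> AF; apply: proper_card; rewrite properEneq subD // andbT.
  by apply: contraNneq DnF => <-.
have [D0|D_gt0] := posnP #|D|.
  by rewrite big1 // => A /ltD; rewrite D0.
have -> : (\sum_(A in F) #|A|`! * (#|D| - #|A|)`! =
    \sum_(x in D) \sum_(A in F | x \notin A) #|A|`! * (#|D|.-1 - #|A|)`!)%N.
  rewrite (exchange_big_dep (mem F)) /=; last by move=> x A _ /andP[].
  apply: eq_bigr => A AF; have lt_AD := ltD A AF.
  have -> : (#|D| - #|A| = (#|D|.-1 - #|A|).+1)%N by lia.
  rewrite factS mulnCA; under eq_bigl do rewrite AF /=.
  rewrite sum_nat_const; congr (_ * _)%N.
  have <- : #|D :\: A| = (#|D|.-1 - #|A|).+1.
    by rewrite cardsD (setIidPr (subD _ AF)); lia.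
  by apply: eq_card => x; rewrite !inE andbC.
apply: (@leq_trans (\sum_(x in D) #|D|.-1`!)); last first.
  by rewrite sum_nat_const -{1 3}(prednK D_gt0) factS.
apply: leq_sum => x xD.
have cardDx : #|D :\ x| = #|D|.-1 by rewrite [#|D|](cardsD1 x) xD.
have := IHk (D :\ x) [set A in F | x \notin A].
rewrite cardDx prednK // => /(_ leDk) IH.
rewrite (eq_bigl (mem [set A in F | x \notin A])) => [|A]; last by rewrite !inE.
apply: IH => [A B|].
  by rewrite !inE => /andP[AF _] /andP[BF _]; apply: antiF.
apply/subsetP=> A; rewrite !inE subsetD1 => /andP[AF ->].
by rewrite subD.
Qed.

(** For each [A], the factorial of [#|T|] is ['C(#|T|, #|A|)] times the term of [A] in the previous
    sum, hence at most the middle binomial times that term. *)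
Lemma sperner (T : finType) (F : {set {set T}}) :
  antichain F -> (#|F| <= 'C(#|T|, uphalf #|T|))%N.
Proof.
move=> antiF; rewrite -(leq_pmul2r (fact_gt0 #|T|)).
have sFT : F \subset powerset [set: T].
  by apply/subsetP=> A _; rewrite powersetE subsetT.
have := lubell_yamamoto_meshalkin antiF sFT; rewrite cardsT => LYM.
apply: leq_trans (leq_mul (leqnn _) LYM).
rewrite -sum_nat_const big_distrr leq_sum // => A _.
by rewrite -(bin_fact (max_card (mem A))) leq_mul2r leq_bin_uphalf orbT.
Qed.

Lemma leq_sperner (n k : nat) (s : 'I_n -> {set 'I_k}) :
  (forall i j, i != j -> ~~ (s i \subset s j)) -> (n <= 'C(k, uphalf k))%N.
Proof.
move=> anti_s; have inj_s : injective s.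
  move=> i j eq_s; apply: contraTeq isT => /anti_s.
  by rewrite eq_s subxx.
have := @sperner _ (s @: setT); rewrite card_imset // cardsT !card_ord; apply.
move=> _ _ /imsetP[i _ ->] /imsetP[j _ ->].
by have [->//|/anti_s/negPf->] := eqVneq i j.
Qed.

(** Sets of the same size are comparable only if equal, so distinct [m]-subsets serve. *)
Lemma exists_sperner_family (n k m : nat) : (n <= 'C(k, m))%N ->
  exists s : 'I_n -> {set 'I_k}, forall i j, i != j -> ~~ (s i \subset s j).
Proof.
rewrite -[k in 'C(k, _)]card_ord -card_draws => le_n.
exists (fun i => enum_val (widen_ord le_n i)) => i j; apply: contraNN => sub_ij.
have /[!inE]/eqP card_i := enum_valP (widen_ord le_n i).
have /[!inE]/eqP card_j := enum_valP (widen_ord le_n j).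
have /eqP/enum_val_inj/(congr1 val)/= eq_ij :
    enum_val (widen_ord le_n i) == enum_val (widen_ord le_n j).
  by rewrite eqEcard sub_ij card_i card_j /=.
exact/eqP/val_inj.
Qed.

Lemma antiring_sum_eq0 (S : pzSemiRingType) (I : finType) (F : I -> S) :
  antiring S -> \sum_i F i = 0 -> forall i, F i = 0.
Proof.
by move=> antiS sum0 i; move: sum0; rewrite (bigD1 i) //= => /antiS[].
Qed.

Section Reduced.

Variable S : pzSemiRingType.
Hypothesis S_reduced : no_nonzero_nilpotent S.

Lemma reduced_sqr_eq0 (a : S) : a * a = 0 -> a = 0.
Proof. by move=> aa0; apply: S_reduced; exists 2; rewrite // expr2. Qed.

(** The square of [b * a] has the inner factor [a * b]. *)
Lemma reduced_mul_eq0C (a b : S) : a * b = 0 -> b * a = 0.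
Proof.
move=> ab0; apply: reduced_sqr_eq0.
by rewrite mulrA -[b * a * b]mulrA ab0 mulr0 mul0r.
Qed.

Lemma reduced_mul_eq0_insert (a x b : S) : a * b = 0 -> a * x * b = 0.
Proof.
move/reduced_mul_eq0C => ba0; apply: reduced_sqr_eq0.
by rewrite -!mulrA [b * _]mulrA ba0 mul0r !mulr0.
Qed.

(* The witness [x] is the product of the chosen [b i (c i)]; it is killed by
   whatever one of its factors kills. *)
Lemma reduced_choice (I : eqType) (K : finType) (k0 : K) (b : I -> K -> S)
    (r : seq I) :
  (1 : S) <> 0 -> (forall i, i \in r -> \sum_k b i k = 1) ->
  exists c : I -> K, {in r &, forall i j, b i (c i) * b j (c j) <> 0}.
Proof.
move=> nz1 sum1.
suff [c [x /eqP nzx killx]] : exists c : I -> K, exists2 x : S, x <> 0 &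
    forall i, i \in r -> forall a, b i (c i) * a = 0 -> x * a = 0.
  (* By [killx i], [x * b j (c j) = 0]; after swapping the factors, [killx j] gives [x * x = 0]. *)
  exists c => i j ir jr bij0; case/eqP: nzx; apply: reduced_sqr_eq0.
  exact/(killx j)/reduced_mul_eq0C/(killx i).
elim: r sum1 => [|i r IHr] sum1; first by exists (fun=> k0), 1.
have [|c [x nzx killx]] := IHr.
  by move=> j jr; apply: sum1; rewrite inE jr orbT.
have [ir|inr] := boolP (i \in r).
  by exists c, x => // j /[!inE] /predU1P[->|]; apply: killx.
(* Otherwise [x], equal to the sum of all [x * b i k], would vanish. *)
have [k nzk] : exists k, x * b i k != 0.
  apply/existsP; apply: contra_notT nzx => /existsPn nok.
  rewrite -[x]mulr1 -(sum1 i) ?mem_head // mulr_sumr big1 // => k _.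
  exact/eqP/negbNE/nok.
exists (fun j => if j == i then k else c j), (x * b i k); first exact/eqP.
move=> j /[!inE]; have [->{j} _ a bia0|ne_ji /= jr a bja0] := eqVneq j i.
  by rewrite -mulrA bia0 mulr0.
exact/reduced_mul_eq0_insert/(killx j).
Qed.

End Reduced.

Lemma square_zero_mul_eq0 (S : pzSemiRingType) (n : nat) (B : 'M[S]_n) :
  antiring S -> square_zero B -> forall i j l, B i j * B j l = 0.
Proof.
move=> antiS /matrixP BB0 i j l; have := BB0 i l; rewrite !mxE.
by move/(antiring_sum_eq0 antiS).
Qed.

Lemma sum_of_square_zero_sperner (S : pzSemiRingType) (n k : nat)
    (A : 'M[S]_n) :
  antiring S -> trace_zero A -> (n <= 'C(k, uphalf k))%N ->
  sum_of_square_zero k A.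
Proof.
move=> antiS /(antiring_sum_eq0 antiS) diag0 /exists_sperner_family[s anti_s].
(* The colour of [(i, j)]. It is [None] on the diagonal, where [A] vanishes anyway. *)
pose f i j := [pick c in s i :\: s j].
have fP i j c : f i j = Some c -> c \in s i :\: s j.
  by rewrite /f; case: pickP => // d ds [<-].
exists (fun c => \matrix_(i, j) if f i j == Some c then A i j else 0) => [c|].
  apply/matrixP=> i l; rewrite !mxE big1 // => j _; rewrite !mxE.
  case: eqP => [/fP|]; last by rewrite mul0r.
  case: eqP => [/fP|]; last by rewrite mulr0.
  by rewrite !inE => /andP[_ ->].
apply/matrixP=> i j; rewrite summxE.
have [<-|/anti_s ne_ij] := eqVneq i j.
  by rewrite big1 ?diag0 // => c _; rewrite mxE diag0 if_same.
have [c fij] : exists c, f i j = Some c.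
  rewrite /f; case: pickP => [c _|none]; first by exists c.
  case/subsetP: ne_ij => c ci; move: (none c); rewrite inE ci andbT.
  by move/negbFE.
rewrite (bigD1 c) //= big1 ?addr0 => [|d ne_dc]; rewrite mxE fij ?eqxx //.
by case: eqP => // -[cd]; rewrite cd eqxx in ne_dc.
Qed.

Lemma sperner_of_sum_of_square_zero (S : pzSemiRingType) (n k : nat) :
  antiring S -> no_nonzero_nilpotent S -> (1 : S) <> 0 ->
  sum_of_square_zero k (\matrix_(i < n, j < n) (i != j)%:R : 'M[S]_n) ->
  (n <= 'C(k, uphalf k))%N.
Proof.
move=> antiS redS nz1 [B sqB /matrixP sumB].
have sum1 i j : i != j -> \sum_c B c i j = 1.
  by move=> ne_ij; rewrite -summxE -sumB mxE ne_ij.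
(* Without colours there is no default [ord0]: the empty sum forces [1 = 0] once [n] is at least 2,
   while [n <= 1] agrees with ['C(0, 0) = 1]. *)
case: k => [|k] in B sqB sumB sum1 *.
  case: n => [|[|n]] // in B sqB sumB sum1 *.
  by case: nz1; rewrite -(sum1 ord0 ord_max) // big_ord0.
pose offdiag := [seq p <- enum {: 'I_n * 'I_n} | p.1 != p.2].
have [|f fP] := reduced_choice redS ord0 (b := fun p c => B c p.1 p.2)
  (r := offdiag) nz1.
  by move=> p; rewrite mem_filter => /andP[/sum1].
have {}fP i j l : i != j -> j != l -> f (i, j) <> f (j, l).
  move=> ne_ij ne_jl eq_f; apply: (fP (i, j) (j, l)).
  - by rewrite mem_filter ne_ij mem_enum.
  - by rewrite mem_filter ne_jl mem_enum.
  - by rewrite /= eq_f; apply: square_zero_mul_eq0.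
apply: (@leq_sperner _ _ (fun i => [set f (i, j) | j : 'I_n & i != j])).
move=> i j ne_ij.
(* The colour of [(i, j)] occurs in row [i] but, by [fP], nowhere in row [j]. *)
apply/subsetPn; exists (f (i, j)); first by apply/imsetP; exists j; rewrite ?inE.
by apply/imsetP=> -[l /[!inE] ne_jl]; apply: fP.
Qed.

Theorem theorem13 (S : pzSemiRingType) (n : nat) (n_gt0 : (0 < n)%N)
    (S_antiring : antiring S) (S_reduced : no_nonzero_nilpotent S) :
  (forall A : 'M[S]_n, trace_zero A ->
     sum_of_square_zero (sperner_number n) A)
  /\
  ((1 : S) <> 0 ->
   exists2 A : 'M[S]_n, trace_zero A &
     forall k : nat, (k < sperner_number n)%N -> ~ sum_of_square_zero k A).
Proof.
rewrite /sperner_number; case: ex_minnP => N leN minN; split=> [A trA|nz1].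
  exact: sum_of_square_zero_sperner.
exists (\matrix_(i, j) (i != j)%:R).
  by rewrite /trace_zero /mxtrace big1 // => i _; rewrite mxE eqxx.
move=> k lt_kN /(sperner_of_sum_of_square_zero S_antiring S_reduced nz1)/minN.
by rewrite leqNgt lt_kN.
Qed.
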